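(* Let $B_n \subset L$ be a Borel subgroup of $L\simeq \mathrm{GL}_n(\mathbb{R})$. Then the double flag variety $G/P_S \times L/B_n$ has finitely many $L$-orbits under the diagonal action of $L$. In other words, $G/P_S$ has finitely many $B_n$-orbits.
   Context: Let $n\ge 1$, $J_n=\begin{pmatrix}0&-1_n\\1_n&0\end{pmatrix}$ and $G=\mathrm{Sp}_{2n}(\mathbb{R})=\{g\in \mathrm{GL}_{2n}(\mathbb{R})\mid {}^tgJ_ng=J_n\}$ acting on $V=\mathbb{R}^{2n}$ with standard basis $e_1,\dots,e_{2n}$. Let $V^+=\mathrm{span}_{\mathbb{R}}\{e_1,\dots,e_n\}$ and $P_S=\{g\in G\mid gV^+=V^+\}$ (the Siegel parabolic subgroup). Let $L=\left\{\begin{pmatrix}a&0\\0&{}^ta^{-1}\end{pmatrix}\,\middle|\, a\in \mathrm{GL}_n(\mathbb{R})\right\}\simeq \mathrm{GL}_n(\mathbb{R})$ be its Levi subgroup. $L$ acts on $G/P_S$ and on $L/B_n$ by left multiplication. A Borel subgroup of $L\simeq\mathrm{GL}_n(\mathbb{R})$ is a conjugate of the group of invertible real upper triangular matrices. *)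

(* Defs.v *)
From HB Require Import structures.
From mathcomp Require Import all_boot all_order all_algebra.
From mathcomp Require Import all_classical all_reals.

Set Implicit Arguments.
Unset Strict Implicit.
Unset Printing Implicit Defensive.

Import Order.TTheory GRing.Theory Num.Theory.
Local Open Scope classical_set_scope.
Local Open Scope ring_scope.

(* Matrix groups are encoded as sets of square matrices, and a homogeneous
   space G/H as the set of left cosets g H, each a set of matrices. *)

Section Orbits.
Variables (K T : Type) (act : K -> T -> T).

Definition orbit_of (H : set K) (x : T) : set T := [set act h x | h in H].

Definition orbits (H : set K) (X : set T) : set (set T) :=
  [set orbit_of H x | x in X].

End Orbits.

Section HomogeneousSpaces.
Variables (R : realType) (N : nat).
Implicit Types (g : 'M[R]_N) (G H A : set 'M[R]_N).

Definition lmul g A : set 'M[R]_N := [set g *m x | x in A].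

Definition left_cosets G H : set (set 'M[R]_N) := [set lmul g H | g in G].

Definition diag_lmul g (p : set 'M[R]_N * set 'M[R]_N) :=
  (lmul g p.1, lmul g p.2).

End HomogeneousSpaces.

Section SymplecticGroup.
Variables (R : realType) (n : nat).

Definition Jmx : 'M[R]_(n + n) := block_mx 0 (- 1%:M) 1%:M 0.

Definition GL : set 'M[R]_n := [set a | a \in unitmx].

Definition Sp : set 'M[R]_(n + n) :=
  [set g | g \in unitmx /\ g^T *m Jmx *m g = Jmx].

Definition Vplus : {vspace 'cV[R]_(n + n)} :=
  <<[seq delta_mx (lshift n i) 0%R | i : 'I_n]>>%VS.

Definition Siegel : set 'M[R]_(n + n) :=
  [set g | Sp g /\ (linfun (mulmx g) @: Vplus)%VS = Vplus].

Definition levi (a : 'M[R]_n) : 'M[R]_(n + n) :=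
  block_mx a 0 0 (invmx a^T).

Definition Levi : set 'M[R]_(n + n) := levi @` GL.

(* [is_trig_mx] is lower triangularity, hence the transpose. *)
Definition upper_triangular : set 'M[R]_n :=
  [set b | GL b /\ is_trig_mx b^T].

(* Conjugation takes place in GL_n, identified with L through [levi]. *)
Definition Borel (B : set 'M[R]_(n + n)) : Prop :=
  exists2 a, GL a &
    B = levi @` [set a *m b *m invmx a | b in upper_triangular].

End SymplecticGroup.

Arguments Jmx R n : clear implicits.
Arguments GL R n : clear implicits.
Arguments Sp R n : clear implicits.
Arguments Vplus R n : clear implicits.
Arguments Siegel R n : clear implicits.
Arguments Levi R n : clear implicits.
Arguments upper_triangular R n : clear implicits.

(* Main.v *)
Require Import Defs.
From mathcomp Require Import all_boot all_order all_algebra.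
From mathcomp Require Import all_classical all_reals.
From mathcomp Require Import ring.

(** A coset [g P_S] is the Lagrangian subspace [g V^+] of [V], that is, the
    span of the columns of the matrix formed by the upper block [C] and the
    lower block [D] of the first [n] columns of [g]; [C^T D] is symmetric, and
    two pairs [(C, D)] define the same coset when they differ by a right factor
    [h] in [GL_n].  An element [b] of [GL_n = L] acts by
    [(C, D) |-> (b C, b^-T D)].  Intrinsically, a Lagrangian subspace is a
    subspace [U] of [R^n] (the column space of [C]) together with a symmetric
    bilinear form on [U] (given by [D]).

    Two classical reductions show that upper triangular [b] suffice to bring
    [(C, D)] to a form with entries in [{-1, 0, 1}], of which there are
    finitely many.  The first is the Bruhat decomposition of the Grassmannian
    ([row_space_pivots]): [U] becomes a coordinate subspace, so that [C] may be
    taken to be the coordinate projection [E] onto a set [A] of coordinates;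
    a suitable [h] then turns [D] into [E D E + (1 - E)], where [E D E] is a
    symmetric form on the coordinates in [A] ([complete_frame]).  What remains
    is the group of the triangular [c] that are the identity outside [A], and
    the second reduction ([sym_congr_sign]) is a triangular version of
    Sylvester's law: a symmetric form on a space with a full flag splits, in a
    basis adapted to the flag, into lines of form [0], [1] or [-1] and
    hyperbolic planes.  The two are combined in [lagrangian_normal_form].

    A general Borel subgroup is a conjugate of the upper triangular one, so its
    representatives are translates of the ones above.  Finally, every [L]-orbit
    on [G/P_S x L/B] meets the slice [G/P_S x {B}], whose stabilizer is [B]:
    representatives for the second factor equal to [B] and for the first in a
    system for the [B]-orbits exhaust the double flag variety. *)

Set Implicit Arguments.
Unset Strict Implicit.
Unset Printing Implicit Defensive.

Import Order.TTheory GRing.Theory Num.Theory.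

Local Open Scope classical_set_scope.
Local Open Scope ring_scope.

(** * Triangular matrices *)

Section TriangularMatrices.
Variable F : fieldType.

Lemma trig_mxM n (a b : 'M[F]_n) :
  is_trig_mx a -> is_trig_mx b -> is_trig_mx (a *m b).
Proof.
move=> /is_trig_mxP ta /is_trig_mxP tb; apply/is_trig_mxP => i j lt_ij.
rewrite mxE big1 // => k _; have [lt_ik|le_ki] := ltnP i k.
  by rewrite ta // mul0r.
by rewrite tb ?mulr0 // (leq_ltn_trans le_ki).
Qed.

Lemma trig_mx_unit n (a : 'M[F]_n) :
  is_trig_mx a -> (a \in unitmx) = [forall i, a i i != 0].
Proof.
move=> ta; rewrite unitmxE det_trig // unitfE.
by apply/prodf_neq0/forallP => h i; first exact: h.
Qed.

(** Forward substitution: entry [i, j] of [a *m a^-1] above the diagonal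
    only involves the entries of column [j] of [a^-1] in rows up to [i]. *)
Lemma trig_mxV n (a : 'M[F]_n) :
  is_trig_mx a -> a \in unitmx -> is_trig_mx (invmx a).
Proof.
move=> ta ua; have /forallP nz_a : [forall i, a i i != 0].
  by rewrite -trig_mx_unit.
apply/is_trig_mxP => i j; have [m] := ubnP (i : nat).
elim: m i => // m IHm i le_im lt_ij.
have : (a *m invmx a) i j = 0 by rewrite mulmxV // mxE -val_eqE ltn_eqF.
rewrite mxE (bigD1 i) //= big1 => [|k ne_ki].
  by rewrite addr0 => /eqP; rewrite mulf_eq0 (negPf (nz_a i)) => /eqP.
have [lt_ik|le_ki] := ltnP i k.
  by rewrite (is_trig_mxP ta) // mul0r.
have lt_ki : (k < i)%N by rewrite ltn_neqAle le_ki -val_eqE andbT in ne_ki *.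
by rewrite IHm ?mulr0 ?(ltn_trans lt_ki lt_ij) ?(leq_trans lt_ki).
Qed.

End TriangularMatrices.

(** * Pivots of a row space *)

Section CoordinateProjections.
Variables (F : fieldType) (n : nat).
Implicit Types (A B : {set 'I_n}) (c : 'M[F]_n).

Definition coord_proj A : 'M[F]_n := diag_mx (\row_i (i \in A)%:R).

Lemma coord_projE A k l : coord_proj A k l = ((k == l) && (k \in A))%:R.
Proof. by rewrite !mxE; case: eqP => [->|]. Qed.

Lemma mul_coord_projE m A (X : 'M[F]_(n, m)) k l :
  (coord_proj A *m X) k l = (k \in A)%:R * X k l.
Proof. by rewrite mul_diag_mx !mxE. Qed.

Lemma mulmx_coord_projE m A (X : 'M[F]_(m, n)) k l :
  (X *m coord_proj A) k l = X k l * (l \in A)%:R.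
Proof. by rewrite mul_mx_diag !mxE. Qed.

Lemma coord_projI A B : coord_proj A *m coord_proj B = coord_proj (A :&: B).
Proof.
apply/matrixP => k l; rewrite mul_coord_projE !coord_projE inE.
by case: (k == l); case: (k \in A); rewrite /= ?mul1r ?mul0r ?mulr0.
Qed.

Lemma tr_coord_proj A : (coord_proj A)^T = coord_proj A.
Proof. exact: tr_diag_mx. Qed.

Lemma coord_projC A : coord_proj A + coord_proj (~: A) = 1%:M.
Proof.
apply/matrixP => k l; rewrite !mxE inE.
by case: eqP => [->|_]; [case: (l \in A)|]; rewrite ?addr0 ?add0r.
Qed.

(** In block form with respect to [A] and its complement, [c] is the direct sum
    of a square block on [A] and of an identity block; the matrix equations make
    stability under products immediate. *)
Definition identity_off A c :=
  c *m coord_proj (~: A) = coord_proj (~: A) /\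
  coord_proj (~: A) *m c = coord_proj (~: A).

Lemma identity_offP A c :
  (forall k l, (k \notin A) || (l \notin A) -> c k l = (k == l)%:R) ->
  identity_off A c.
Proof.
move=> hc; split; apply/matrixP => k l.
  rewrite mulmx_coord_projE coord_projE !inE; case lA: (l \in A) => /=.
    by rewrite mulr0; case: eqP => //= ->; rewrite lA.
  by rewrite mulr1 hc ?lA ?orbT //; case: eqP => //= ->; rewrite lA.
rewrite mul_coord_projE coord_projE !inE; case kA: (k \in A) => /=.
  by rewrite mul0r andbF.
by rewrite mul1r hc ?kA // andbT.
Qed.

Lemma identity_offS A B c : B \subset A -> identity_off B c -> identity_off A c.
Proof.
move=> sBA [hl hr]; have eP : ~: A = ~: B :&: ~: A.
  by apply/esym/finset.setIidPr; rewrite finset.setCS.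
split; first by rewrite eP -coord_projI mulmxA hl.
by rewrite eP finset.setIC -coord_projI -mulmxA hr.
Qed.

Lemma identity_offM A c d :
  identity_off A c -> identity_off A d -> identity_off A (c *m d).
Proof.
by move=> [cl cr] [dl dr]; split; rewrite -?mulmxA ?dl // mulmxA cr.
Qed.

Lemma identity_off_comm A c :
  identity_off A c -> c *m coord_proj A = coord_proj A *m c.
Proof.
have -> : coord_proj A = 1%:M - coord_proj (~: A).
  by rewrite -(coord_projC A) addrK.
by move=> [hl hr]; rewrite mulmxBr mulmxBl hl hr mulmx1 mul1mx.
Qed.

End CoordinateProjections.

(** Take for [A] the set of pivots of [X], i.e. the positions of the last
    nonzero entries of the vectors in its row space; choosing a vector with
    last entry 1 at each pivot gives the rows of [T] with index in [A].  The
    vectors of the row space are then reduced to 0 from the right.  This is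
    the decomposition of the Grassmannian into Bruhat cells. *)
Lemma row_space_pivots (F : fieldType) m n (X : 'M[F]_(m, n)) :
  exists A : {set 'I_n}, exists2 T : 'M[F]_n,
    is_trig_mx T /\ T \in unitmx & (X :=: coord_proj F A *m T)%MS.
Proof.
pose pivot (j : 'I_n) (u : 'rV[F]_n) :=
  [/\ (u <= X)%MS, u 0 j = 1 & forall k : 'I_n, (j < k)%N -> u 0 k = 0].
pose A := [set j | `[< exists u, pivot j u >]]%SET.
have pivotal (j : 'I_n) : exists u : 'rV[F]_n,
    [/\ (j \in A) -> pivot j u, u 0 j = 1
      & forall k : 'I_n, (j < k)%N -> u 0 k = 0].
  have [jA|jNA] := boolP (j \in A).
    by move: (jA); rewrite inE => /asboolP[u pu]; exists u; case: (pu).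
  (* Unit vectors in the other rows make [T] unitriangular. *)
  exists (delta_mx 0 j); rewrite mxE !eqxx; split=> // k lt_jk.
  by rewrite mxE eqxx /= -val_eqE gtn_eqF.
have [t tP] := boolp.choice pivotal.
pose T := \matrix_j t j.
have tT : is_trig_mx T.
  by apply/is_trig_mxP => i j; case: (tP i) => _ _; rewrite mxE; apply.
exists A, T; first split=> //.
  rewrite trig_mx_unit //; apply/forallP => j; rewrite mxE.
  by case: (tP j) => _ -> _; rewrite oner_neq0.
have rowAT j : row j (coord_proj F A *m T) = (j \in A)%:R *: t j.
  by apply/rowP => k; rewrite mxE mul_coord_projE !mxE.
apply/eqmxP/andP; split; last first.
  apply/row_subP => j; rewrite rowAT; case: (boolP (j \in A)) => [jA|_].
    by rewrite scale1r; case: (tP j) => /(_ jA)[].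
  by rewrite scale0r sub0mx.
(* Induction on the number [d] of leading entries allowed to be nonzero. *)
suff red d : forall v : 'rV[F]_n, (v <= X)%MS ->
    (forall k : 'I_n, (d <= k)%N -> v 0 k = 0) ->
    (v <= coord_proj F A *m T)%MS.
  apply/row_subP => i; apply: (red n); first exact: row_sub.
  by move=> k; rewrite leqNgt ltn_ord.
elim: d => [|d IHd] v vX v0.
  by have -> : v = 0 by [apply/rowP => k; rewrite mxE v0]; rewrite sub0mx.
have [lt_dn|le_nd] := ltnP d n; last first.
  by apply: IHd => // k le_dk; have := leq_trans le_nd le_dk; rewrite leqNgt ltn_ord.
pose j := Ordinal lt_dn.
have v0' (k : 'I_n) : (j < k)%N -> v 0 k = 0 by move=> lt_jk; rewrite v0.
have [vj0|vjn0] := eqVneq (v 0 j) 0.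
  apply: IHd => // k; rewrite leq_eqVlt => /orP[/eqP e_dk|/v0//].
  by rewrite (_ : k = j) //; apply: val_inj.
have jA : j \in A.
  rewrite inE; apply/asboolP; exists ((v 0 j)^-1 *: v); split.
  - exact: scalemx_sub.
  - by rewrite mxE mulVf.
  - by move=> k lt_jk; rewrite mxE (v0' k) ?mulr0.
have [/(_ jA)[tX _ _] tj1 tj0] := tP j.
rewrite -(subrK (v 0 j *: t j) v); apply: addmx_sub.
  apply: IHd => [|k].
    by rewrite addmx_sub // eqmx_opp scalemx_sub.
  rewrite !mxE leq_eqVlt => /orP[/eqP e_dk|lt_dk].
    by rewrite (_ : k = j) ?tj1 ?mulr1 ?subrr //; apply: val_inj.
  by rewrite (v0' k) // tj0 // mulr0 subrr.
apply: scalemx_sub; have := rowAT j; rewrite jA scale1r => <-; exact: row_sub.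
Qed.

(** * Symmetric forms up to triangular congruence *)

Section Congruence.
Variables (F : fieldType) (n : nat).
Implicit Types (i j : 'I_n) (M : 'M[F]_n) (a b : 'I_n -> F).

(** Simultaneous row operations with two pivot rows [i] and [j], as splitting
    off a hyperbolic plane requires. *)
Definition shear (i j : 'I_n) a b : 'M[F]_n :=
  1%:M + (\col_k a k) *m delta_mx 0 i + (\col_k b k) *m delta_mx 0 j.

Lemma shearE i j a b k l :
  shear i j a b k l = (k == l)%:R + a k * (l == i)%:R + b k * (l == j)%:R.
Proof. by rewrite !mxE !big_ord1 !mxE. Qed.

Lemma mul_shearE m i j a b (X : 'M[F]_(n, m)) k l :
  (shear i j a b *m X) k l = X k l + a k * X i l + b k * X j l.
Proof.
by rewrite !mulmxDl mul1mx -!mulmxA -!rowE !mxE !big_ord1 !mxE.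
Qed.

Lemma shear_congrE i j a b M k l : M^T = M ->
  (shear i j a b *m M *m (shear i j a b)^T) k l =
    M k l + a k * M i l + b k * M j l
    + a l * (M k i + a k * M i i + b k * M j i)
    + b l * (M k j + a k * M i j + b k * M j j).
Proof.
move=> sM; set c := shear _ _ _ _.
have -> : c *m M *m c^T = (c *m (c *m M)^T)^T by rewrite trmx_mul trmxK.
by rewrite mxE mul_shearE ![(c *m M)^T _ _]mxE !mul_shearE.
Qed.

Lemma shear_trig i j a b :
    (forall k : 'I_n, (k < i)%N -> a k = 0) ->
    (forall k : 'I_n, (k < j)%N -> b k = 0) ->
  is_trig_mx (shear i j a b).
Proof.
move=> ha hb; apply/is_trig_mxP => k l lt_kl; rewrite shearE.
rewrite -[k == l]val_eqE ltn_eqF // add0r.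
have [e|_] := eqVneq l i; have [e'|_] := eqVneq l j; rewrite ?mulr0 ?addr0 //.
- by rewrite ha -?e // hb -?e' // !mul0r addr0.
- by rewrite ha -?e // mul0r.
- by rewrite hb -?e' // mul0r addr0.
Qed.

Lemma shear_unit i j a b : is_trig_mx (shear i j a b) ->
  1 + a i != 0 -> b j = 0 -> shear i j a b \in unitmx.
Proof.
move=> tc hi hj; rewrite trig_mx_unit //; apply/forallP => k.
rewrite shearE eqxx; have [->|_] := eqVneq k j.
  rewrite hj mul0r addr0; have [->|_] := eqVneq j i; first by rewrite mulr1.
  by rewrite mulr0 addr0 oner_neq0.
rewrite mulr0 addr0; have [->|_] := eqVneq k i; first by rewrite mulr1.
by rewrite mulr0 addr0 oner_neq0.
Qed.

Lemma shear_identity_off (A : {set 'I_n}) i j a b : i \in A -> j \in A ->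
    (forall k, k \notin A -> a k = 0) -> (forall k, k \notin A -> b k = 0) ->
  identity_off A (shear i j a b).
Proof.
move=> iA jA ha hb; apply: identity_offP => k l; rewrite shearE.
case/orP => [kA|lA]; first by rewrite ha // hb // !mul0r !addr0.
have /negPf -> : l != i by apply: contraNneq lA => ->.
have /negPf -> : l != j by apply: contraNneq lA => ->.
by rewrite !mulr0 !addr0.
Qed.

End Congruence.

Definition is_sign (F : rcfType) (x : F) := x \in [:: 0; 1; -1].

Section SymmetricForms.
Variables (F : rcfType) (n : nat).
Implicit Types (i j : 'I_n) (M : 'M[F]_n) (A : {set 'I_n}).

(** The invariant of the reduction: the coordinates outside [A] are done with,
    so that the form may be studied on those in [A] alone. *)
Definition split_off A M :=
  forall k l, k \notin A -> is_sign (M k l) /\ (l \in A -> M k l = 0).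

(** One step of the reduction: the congruence by [c] splits off the coordinates
    in [A] but not in [A'] while leaving alone those split off before. *)
Definition reduces A A' M c :=
  [/\ is_trig_mx c, c \in unitmx, identity_off A c
    & split_off A' (c *m M *m c^T)].

Lemma is_sign0 : is_sign (0 : F). Proof. by rewrite /is_sign !inE eqxx. Qed.
Lemma is_sign1 : is_sign (1 : F). Proof. by rewrite /is_sign !inE eqxx orbT. Qed.

(** A coordinate [i] with [M i i != 0] spans a nondegenerate line: scale it to
    [1] or [-1] and subtract its multiples from the others.  The
    congruence is triangular because [i] is the first element of [A]. *)
Lemma reduce_anisotropic A M i : M^T = M -> split_off A M ->
  i \in A -> (forall k, k \in A -> (i <= k)%N) -> M i i != 0 ->
  exists c, reduces A (A :\ i) M c.
Proof.
move=> sM hM iA min_i Mii.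
have symM k l : M k l = M l k by rewrite -{1}sM mxE.
have Mi0 k : k \notin A -> M i k = 0.
  by move=> kA; rewrite symM; case: (hM k i kA) => _ ->.
have ltiA (k : 'I_n) : (k < i)%N -> k \notin A.
  by move=> lt_ki; apply/negP => /min_i; rewrite leqNgt lt_ki.
have nA_i k : k \notin A -> k != i by apply: contraNneq => ->.
pose s := (Num.sqrt `|M i i|)^-1.
have s0 : s != 0 by rewrite invr_neq0 // sqrtr_eq0 -ltNge normr_gt0.
have sgMs : is_sign (s ^+ 2 * M i i).
  rewrite /s exprVn sqr_sqrtr ?normr_ge0 // /is_sign !inE.
  have [M0|M0|/eqP] := ltrgt0P (M i i); last by rewrite (negPf Mii).
    by rewrite mulVf ?eqxx ?orbT.
  by rewrite invrN mulNr mulVf ?eqxx ?orbT.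
pose a k := if k == i then s - 1 else - M i k / M i i.
have a0 k : k \notin A -> a k = 0.
  by move=> kA; rewrite /a (negPf (nA_i k kA)) Mi0 // oppr0 mul0r.
pose c := shear i i a (fun=> 0); exists c.
have tc : is_trig_mx c by apply: shear_trig => // k /ltiA/a0.
split=> //.
- by apply: shear_unit => //; rewrite /a eqxx addrC subrK.
- by apply: shear_identity_off.
move=> k l kA'; rewrite shear_congrE // !mul0r !addr0 (symM k i).
move: kA'; rewrite !inE negb_and negbK /a => hk.
have [->|ki] := eqVneq k i.
  have [->|li] := eqVneq l i => /=.
    split=> //; rewrite (_ : _ + _ = s ^+ 2 * M i i) //.
    by ring.
  rewrite (_ : _ + _ = 0); first by split=> //; exact: is_sign0.
  by field.
have kA : k \notin A by move: hk; rewrite (negPf ki).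
rewrite (Mi0 _ kA) oppr0 !mul0r !addr0 mulr0 addr0.
by have [h1 h2] := hM k l kA; split=> // /andP[_ /h2].
Qed.

(** A null coordinate [i] with [M i j != 0] spans together with [j] a
    hyperbolic plane: the row of [i] is cleared by subtracting multiples of [j]
    from later coordinates (so [j] has to be the first one pairing with [i]),
    then that of [j] by subtracting multiples of [i]. *)
Lemma reduce_hyperbolic A M i j : M^T = M -> split_off A M ->
  i \in A -> (forall k, k \in A -> (i <= k)%N) -> M i i = 0 ->
  M i j != 0 -> (forall k, M i k != 0 -> (j <= k)%N) ->
  exists c, reduces A (A :\ i :\ j) M c.
Proof.
move=> sM hM iA min_i Mii Mij min_j.
have symM k l : M k l = M l k by rewrite -{1}sM mxE.
have Mi0 k : k \notin A -> M i k = 0.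
  by move=> kA; rewrite symM; case: (hM k i kA) => _ ->.
have jA : j \in A by apply: contraNT Mij => /Mi0->.
have Mj0 k : k \notin A -> M j k = 0.
  by move=> kA; rewrite symM; case: (hM k j kA) => _ ->.
have ltiA (k : 'I_n) : (k < i)%N -> k \notin A.
  by move=> lt_ki; apply/negP => /min_i; rewrite leqNgt lt_ki.
have nA_i k : k \notin A -> k != i by apply: contraNneq => ->.
have nA_j k : k \notin A -> k != j by apply: contraNneq => ->.
have ji : j != i by apply: contraNneq Mij => ->; rewrite Mii.
have ij : i != j by rewrite eq_sym.
(* [a i] rescales [i] so that it pairs to 1 with [j]; [a j] makes [j] null; the
   remaining coefficients clear the rows of [i] and [j]. *)
pose a k := if k == i then (M i j)^-1 - 1
            else if k == j then - M j j / (2 * M i j)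
            else (M i k * M j j / M i j - M j k) / M i j.
pose b k := if (k == i) || (k == j) then 0 else - M i k / M i j.
have a0 k : k \notin A -> a k = 0.
  move=> kA; rewrite /a (negPf (nA_i k kA)) (negPf (nA_j k kA)) (Mi0 k) // (Mj0 k) //.
  by rewrite !mul0r subr0 mul0r.
have b0 k : M i k = 0 -> b k = 0.
  by rewrite /b => ->; rewrite oppr0 mul0r if_same.
pose c := shear i j a b; exists c.
have tc : is_trig_mx c.
  apply: shear_trig => [k /ltiA/a0 //|k lt_kj]; apply: b0.
  by apply/eqP; apply: contraTT lt_kj => /min_j; rewrite -leqNgt.
split=> //.
- by apply: shear_unit => //; rewrite ?/a ?/b ?eqxx ?orbT // addrC subrK invr_neq0.
- by apply: shear_identity_off => // k /Mi0/b0.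
move=> k l kA'; rewrite shear_congrE // (symM k i) (symM k j) (symM j i) Mii.
have two0 : (2 : F) != 0 by rewrite pnatr_eq0.
move: kA'; rewrite !inE !negb_and !negbK => hk.
have [ek|ki] := eqVneq k i.
  have [->|lj] := eqVneq l j;
    rewrite ek ?(symM j i) /a /b ?eqxx ?(negPf ij) ?(negPf ji) ?orbT /=.
    rewrite Mii; split=> //; rewrite (_ : _ + _ = 1) ?is_sign1 //.
    by field; rewrite ?Mij ?two0.
  rewrite (negPf lj); have [->|li] := eqVneq l i; rewrite /= ?Mii.
    by split=> //; rewrite (_ : _ + _ = 0) ?is_sign0 //; ring.
  by rewrite (_ : _ + _ = 0) ?is_sign0 //; field; rewrite ?Mij ?two0.
have [ek|kj] := eqVneq k j.
  have [->|lj] := eqVneq l j;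
    rewrite ek ?(symM j i) /a /b ?eqxx ?(negPf ij) ?(negPf ji) ?orbT /=.
    rewrite (_ : _ + _ = 0) ?is_sign0 //.
    by field; rewrite ?Mij ?two0.
  rewrite (negPf lj); have [->|li] := eqVneq l i; rewrite /= ?Mii.
    split=> //; rewrite (_ : _ + _ = 1) ?is_sign1 // (symM j i).
    by field; rewrite ?Mij ?two0.
  by rewrite (_ : _ + _ = 0) ?is_sign0 //; field; rewrite ?Mij ?two0.
have kA : k \notin A by move: hk; rewrite (negPf ki) (negPf kj).
rewrite (Mi0 _ kA) (Mj0 _ kA) (a0 k kA) (b0 k (Mi0 k kA)) !mul0r !addr0 !mulr0 !addr0.
by have [h1 h2] := hM k l kA; split=> // /and3P[_ _ /h2].
Qed.

(** The case left out by the two previous lemmas is that of a coordinate in the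
    radical of the form, which is split off as it stands. *)
Lemma reduce_step A M : M^T = M -> split_off A M -> A != finset.set0 ->
  exists c, exists2 A' : {set 'I_n}, A' \proper A & reduces A A' M c.
Proof.
move=> sM hM /set0Pn[i0 i0A].
case: (arg_minnP val i0A) => i iA min_i.
have [Mii|Mii] := eqVneq (M i i) 0; last first.
  have [c hc] := reduce_anisotropic sM hM iA min_i Mii.
  by exists c, (A :\ i) => //; rewrite properD1.
have [[j0 Mij0]|Mi0] := pselect (exists j, M i j != 0).
  case: (@arg_minnP _ j0 (fun j => M i j != 0) val Mij0) => j Mij min_j.
  have [c hc] := reduce_hyperbolic sM hM iA min_i Mii Mij min_j.
  exists c, (A :\ i :\ j) => //.
  by rewrite (sub_proper_trans (subD1set _ _)) // properD1.
exists 1%:M, (A :\ i); first by rewrite properD1.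
split; rewrite ?scalar_mx_is_trig ?unitmx1 //.
  by split; rewrite ?mulmx1 ?mul1mx.
rewrite trmx1 mulmx1 mul1mx => k l; rewrite !inE negb_and negbK.
have [-> _|_ /= kA] := eqVneq k i; last first.
  by have [h1 h2] := hM k l kA; split=> // /andP[_ /h2].
suff -> : M i l = 0 by split=> //; exact: is_sign0.
by apply/eqP; apply: contra_notT Mi0 => nz; exists l.
Qed.

(** Only the coordinates in [A] are modified: this lets the congruence preserve
    the coordinate projection onto [A]. *)
Lemma sym_congr_sign A M : M^T = M -> split_off A M ->
  exists c, [/\ is_trig_mx c, c \in unitmx, identity_off A c
              & forall k l, is_sign ((c *m M *m c^T) k l)].
Proof.
have [m] := ubnP #|A|; elim: m A M => // m IHm A M leAm sM hM.
have [A0|An0] := eqVneq A finset.set0.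
  exists 1%:M; split; rewrite ?scalar_mx_is_trig ?unitmx1 //.
    by split; rewrite ?mulmx1 ?mul1mx.
  by move=> k l; rewrite trmx1 mulmx1 mul1mx; case: (hM k l); rewrite ?A0 ?inE.
have [c [A' prA [tc uc ic hM']]] := reduce_step sM hM An0.
have sM' : (c *m M *m c^T)^T = c *m M *m c^T.
  by rewrite !trmx_mul trmxK sM mulmxA.
have [|d [td ud id hd]] := IHm A' _ _ sM' hM'.
  by rewrite (leq_trans (proper_card prA)).
exists (d *m c); split; rewrite ?trig_mxM ?unitmx_mul ?ud //.
  by apply: identity_offM => //; apply: identity_offS id; exact: proper_sub.
by move=> k l; rewrite trmx_mul -!mulmxA; have := hd k l; rewrite -!mulmxA.
Qed.

End SymmetricForms.


(** * Normal form of a Lagrangian frame *)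

(** With [k := E + (1 - E) D] one has [E k = E] and
    [D = (D^T E + (1 - E)) k]: both [E] and [D] are left multiples of [k], which
    is therefore invertible since [E] and [D] have jointly full rank.  Take
    [h := k^-1]. *)
Lemma complete_frame (F : fieldType) n (E D X Y : 'M[F]_n) :
    E *m E = E -> E *m D = D^T *m E -> X *m E + Y *m D = 1%:M ->
  exists2 h, h \in unitmx
    & E *m h = E /\ D *m h = E *m D *m E + (1%:M - E).
Proof.
move=> EE ED XY; pose G := 1%:M - E.
have EG : E *m G = 0 by rewrite mulmxBr mulmx1 EE subrr.
have GG : G *m G = G by rewrite {1}/G mulmxBl mul1mx EG subr0.
have GE : G *m E = 0 by rewrite mulmxBl mul1mx EE subrr.
pose k := E + G *m D.
have Ek : E *m k = E by rewrite mulmxDr EE mulmxA EG mul0mx addr0.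
have Gk : G *m k = G *m D by rewrite mulmxDr GE mulmxA GG add0r.
have Dk : (D^T *m E + G) *m k = D.
  by rewrite mulmxDl -mulmxA Ek Gk -ED -mulmxDl /G addrC subrK mul1mx.
have [_ uk] : X *m E + Y *m (D^T *m E + G) \in unitmx /\ k \in unitmx.
  by apply: mulmx1_unit; rewrite mulmxDl -!mulmxA Ek Dk.
exists (invmx k); first by rewrite unitmx_inv.
have Eh : E *m invmx k = E by rewrite -{1}Ek mulmxK.
by split=> //; rewrite -{1}Dk mulmxK // ED -mulmxA EE.
Qed.

(** The pivots of [C^T] give [C = T^T E Q] with [T] lower triangular and [Q]
    invertible.  After replacing [(C, D)] by [(E, T D Q^-1)] and completing the
    frame, the second matrix is symmetric and the first is [E]; the congruence
    by [c] that normalizes the second comes from the simultaneous action of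
    [c^-T] on the left and [c^T] on the right, which fixes [E] because [c] is
    block diagonal. *)
Lemma lagrangian_normal_form (F : rcfType) n (C D X Y : 'M[F]_n) :
    C^T *m D = D^T *m C -> X *m C + Y *m D = 1%:M ->
  exists c, exists2 h, [/\ is_trig_mx c, c \in unitmx & h \in unitmx]
    & forall i j, is_sign ((invmx c^T *m C *m h) i j) /\
                  is_sign ((c *m D *m h) i j).
Proof.
move=> CD XY; have [A [T [tT uT] /eqmxP/eqmxMunitP[P uP eC]]] :=
  row_space_pivots C^T.
set E := coord_proj F A in eC; pose Q := P^T.
have uQ : Q \in unitmx by rewrite unitmx_tr.
have uTt : T^T \in unitmx by rewrite unitmx_tr.
have tE : E^T = E by exact: tr_coord_proj.
have {}eC : C = T^T *m E *m Q.
  by rewrite -[C]trmxK eC !trmx_mul tE.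
have EE : E *m E = E by rewrite coord_projI finset.setIid.
pose D1 := T *m D *m invmx Q.
have ED1 : E *m D1 = D1^T *m E.
  have -> : E *m D1 = invmx Q^T *m (C^T *m D) *m invmx Q.
    rewrite eC !trmx_mul trmxK tE !mulmxA mulVmx ?unitmx_tr // mul1mx.
    by rewrite trmxK.
  rewrite CD eC !trmx_mul trmx_inv !mulmxA.
  by rewrite mulmxK.
have XY1 : (Q *m X *m T^T) *m E + (Q *m Y *m invmx T) *m D1 = 1%:M.
  have := congr1 (fun Z => Q *m Z *m invmx Q) XY.
  rewrite mulmx1 mulmxV // => <-; rewrite mulmxDr mulmxDl; congr (_ + _).
    by rewrite eC !mulmxA mulmxK.
  by rewrite /D1 !mulmxA mulmxKV.
have [h1 uh1 [Eh1 Dh1]] := complete_frame EE ED1 XY1.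
set M := _ + _ in Dh1.
have sM : M^T = M.
  rewrite /M linearD linearB /= (trmx_mul _ E) (trmx_mul E) tE trmx1 -ED1 mulmxA EE.
  by rewrite ED1 -mulmxA EE.
have hM : split_off A M.
  move=> k l kA.
  have -> : M k l = (E *m D1 *m E) k l + ((k == l)%:R - E k l).
    by rewrite [LHS]mxE; congr (_ + _); rewrite !mxE.
  rewrite mulmx_coord_projE mul_coord_projE coord_projE.
  rewrite (negPf kA) andbF !mul0r add0r subr0; split=> [|lA].
    by case: (k == l); rewrite ?is_sign0 ?is_sign1.
  by case: eqP kA => // ->; rewrite lA.
have [c [tc uc ic hc]] := sym_congr_sign sM hM.
have cE := identity_off_comm ic.
have uct : c^T \in unitmx by rewrite unitmx_tr.
exists (c *m T), (invmx Q *m h1 *m c^T).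
  by rewrite trig_mxM ?unitmx_mul ?unitmx_inv ?uc ?uct ?uT ?uh1 ?uQ.
move=> i j; split.
  suff -> : invmx (c *m T)^T *m C *m (invmx Q *m h1 *m c^T) = E.
    by rewrite coord_projE; case: (_ && _); rewrite ?is_sign0 ?is_sign1.
  apply: (@can_inj _ _ _ _ (mulKmx (_ : (c *m T)^T \in unitmx))).
    by rewrite unitmx_tr unitmx_mul uc.
  rewrite !mulmxA mulmxV ?unitmx_tr ?unitmx_mul ?uc // mul1mx.
  rewrite eC (mulmxK uQ) -[_ *m E *m h1]mulmxA Eh1 trmx_mul -!mulmxA.
  by congr (_ *m _); rewrite -tE -!trmx_mul cE.
suff -> : c *m T *m D *m (invmx Q *m h1 *m c^T) = c *m M *m c^T by exact: hc.
by rewrite -Dh1 /D1 !mulmxA.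
Qed.

(** * The Siegel cosets as Lagrangian subspaces *)

Section SymplecticGroup.
Variables (R : realType) (n : nat).
Implicit Types (g p : 'M[R]_(n + n)) (a : 'M[R]_n).

Lemma Sp_unit g : Sp R n g -> g \in unitmx. Proof. by case. Qed.

Lemma SpM g p : Sp R n g -> Sp R n p -> Sp R n (g *m p).
Proof.
move=> [ug Jg] [up Jp]; split; first by rewrite unitmx_mul ug.
by rewrite trmx_mul -!mulmxA (mulmxA _ (Jmx R n)) (mulmxA _ g) Jg mulmxA.
Qed.

Lemma SpV g : Sp R n g -> Sp R n (invmx g).
Proof.
move=> [ug Jg]; split; first by rewrite unitmx_inv.
by rewrite -{1}Jg trmx_inv -!mulmxA mulmxV // mulmx1 mulKmx ?unitmx_tr.
Qed.

Lemma leviM a b : a \in unitmx -> b \in unitmx ->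
  levi (a *m b) = levi a *m levi b :> 'M[R]_(n + n).
Proof.
move=> ua ub; rewrite /levi mulmx_block !mulmx0 !mul0mx !addr0 add0r.
congr block_mx.
have uat : a^T \in unitmx by rewrite unitmx_tr.
have ubt : b^T \in unitmx by rewrite unitmx_tr.
rewrite trmx_mul; apply: (@can_inj _ _ _ _ (mulKmx (_ : b^T *m a^T \in unitmx))).
  by rewrite unitmx_mul ubt.
by rewrite mulmxV ?unitmx_mul ?ubt // !mulmxA mulmxK // mulmxV.
Qed.

Lemma levi1 : levi 1%:M = 1%:M :> 'M[R]_(n + n).
Proof. by rewrite /levi trmx1 invmx1 -scalar_mx_block. Qed.

Lemma levi_unit a : a \in unitmx -> levi a \in unitmx.
Proof.
move=> ua; have : levi a *m levi (invmx a) = 1%:M.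
  by rewrite -leviM ?unitmx_inv // mulmxV // levi1.
by case/mulmx1_unit.
Qed.

Lemma leviV a : a \in unitmx -> levi (invmx a) = invmx (levi a).
Proof.
move=> ua; rewrite -[LHS](mulKmx (levi_unit ua)) -leviM ?unitmx_inv //.
by rewrite mulmxV // levi1 mulmx1.
Qed.

Lemma Sp_levi a : a \in unitmx -> Sp R n (levi a).
Proof.
move=> ua; split; first exact: levi_unit.
rewrite /levi /Jmx tr_block_mx !mulmx_block !trmx0 trmx_inv trmxK.
rewrite !(mulmx0, mul0mx, addr0, add0r) mulmxN mulmx1 mulNmx mulmx1.
by rewrite mulmxV ?unitmx_tr // mulVmx.
Qed.

Lemma memVplus (v : 'cV[R]_(n + n)) : (v \in Vplus R n) = (dsubmx v == 0).
Proof.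
apply/idP/eqP => [vV|v0].
  have sub : (Vplus R n <= lker (linfun (mulmx (row_mx 0 (1%:M : 'M[R]_n)))))%VS.
    apply/span_subvP => u /fintype.imageP[i _ ->]; rewrite memv_ker lfunE /=.
    by rewrite -colE; apply/eqP/colP => k; rewrite mxE row_mxEl !mxE.
  have := subvP sub _ vV; rewrite memv_ker lfunE /= => /eqP.
  by rewrite -{1}[v]vsubmxK mul_row_col mul0mx mul1mx add0r.
have -> : v = \sum_(i < n) v (lshift n i) 0 *: delta_mx (lshift n i) 0.
  rewrite -{1}[v]vsubmxK v0; apply/colP => k; rewrite summxE.
  rewrite -(splitK k); case: (fintype.split k) => k' /=.
    rewrite col_mxEu (bigD1 k') //= big1 ?addr0 => [|i ne_i].
      by rewrite !mxE !eqxx mulr1.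
    by rewrite !mxE eq_lshift eq_sym (negPf ne_i) mulr0.
  by rewrite col_mxEd mxE big1 // => i _; rewrite !mxE eq_rlshift mulr0.
apply: memv_suml => i _; apply: memvZ; apply: memv_span; exact: fintype.image_f.
Qed.

(** Elements of [Sp] lie in the same coset of [P_S] when they map [V^+] to the
    same subspace.  Naming this subspace by any of its frames [X], rather than by
    an element of [Sp], allows changing the frame freely. *)
Definition frame_class (X : 'M[R]_(n + n, n)) : set 'M[R]_(n + n) :=
  [set g | Sp R n g /\ exists2 h, h \in unitmx & lsubmx g = X *m h].

Lemma frame_classM X h : h \in unitmx -> frame_class (X *m h) = frame_class X.
Proof.
move=> uh; apply/seteqP; split=> g [Sg [k uk eg]]; split=> //.
  by exists (h *m k); rewrite ?unitmx_mul ?uh // mulmxA.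
by exists (invmx h *m k); rewrite ?unitmx_mul ?unitmx_inv ?uh // mulmxA mulmxK.
Qed.

Lemma lmul_frame_class g X : Sp R n g ->
  lmul g (frame_class X) = frame_class (g *m X).
Proof.
move=> Sg; apply/seteqP; split=> [_ [p [Sp_p [h uh ep]] <-]|p [Sp_p [h uh ep]]].
  split; first exact: SpM.
  by exists h => //; rewrite -mulmx_lsub ep mulmxA.
exists (invmx g *m p); last by rewrite mulKVmx // Sp_unit.
split; first by apply: SpM => //; exact: SpV.
by exists h => //; rewrite -mulmx_lsub ep -mulmxA mulKmx // Sp_unit.
Qed.

Lemma mul_col_mx10 g : g *m col_mx 1%:M 0 = lsubmx g.
Proof. by rewrite -{1}[g]hsubmxK mul_row_col mulmx1 mulmx0 addr0. Qed.

Lemma SiegelE : Siegel R n = frame_class (col_mx 1%:M 0).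
Proof.
apply/seteqP; split=> g [Sg hg]; split=> //.
  have dl0 : dlsubmx g = 0.
    apply/matrixP => i j; rewrite !mxE.
    have /(memv_img (linfun (mulmx g))) : delta_mx (lshift n j) 0 \in Vplus R n.
      by apply: memv_span; exact: fintype.image_f.
    rewrite hg memVplus lfunE /= -colE => /eqP/colP/(_ i).
    by rewrite !mxE.
  exists (ulsubmx g); last first.
    by rewrite mul_col_mx mul1mx mul0mx -{1}[g]submxK dl0 block_mxEh row_mxKl.
  have := Sp_unit Sg; rewrite -{1}[g]submxK dl0 !unitmxE det_ublock.
  by rewrite unitrM => /andP[].
case: hg => h uh eg; apply/eqP; rewrite eqEdim limg_dim_eq ?leqnn ?andbT.
  apply/subvP => _ /memv_imgP[v vV ->]; move: vV; rewrite !memVplus lfunE /=.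
  move=> /eqP v0; rewrite -[v]vsubmxK v0 -[g]hsubmxK mul_row_col mulmx0 addr0.
  by rewrite eg mul_col_mx mul_col_mx col_mxKd !mul0mx.
have /lker0P/eqP -> : injective (linfun (mulmx g) : 'Hom('cV[R]_(n + n), _)).
  by move=> u v; rewrite !lfunE; exact: (can_inj (mulKmx (Sp_unit Sg))).
exact: capv0.
Qed.

Lemma lmul_Siegel g : Sp R n g ->
  lmul g (Siegel R n) = frame_class (lsubmx g).
Proof. by move=> Sg; rewrite SiegelE lmul_frame_class // mul_col_mx10. Qed.

(** Both facts are upper left blocks: of [g^T J g = J] and of [g^-1 g = 1]. *)
Lemma Sp_lagrangian g (C := ulsubmx g) (D := dlsubmx g) : Sp R n g ->
  C^T *m D = D^T *m C /\ exists X Y, X *m C + Y *m D = 1%:M.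
Proof.
move=> [ug Jg]; split.
  move: Jg; rewrite -{1 2}[g]submxK tr_block_mx /Jmx !mulmx_block.
  rewrite !(mulmx0, mul0mx, addr0, add0r, mulmxN, mulmx1).
  case/eq_block_mx => /eqP + _ _ _.
  by rewrite mulNmx addr_eq0 opprK => /eqP.
exists (ulsubmx (invmx g)), (ursubmx (invmx g)).
have := mulVmx ug; rewrite -[X in X *m _]submxK -[X in _ *m X]submxK mulmx_block.
by rewrite scalar_mx_block => /eq_block_mx[].
Qed.

(** A frame [X] need not be Lagrangian here, in which case its class is empty:
    the family only has to be finite and to contain the normal forms. *)
Definition sign_cosets : set (set 'M[R]_(n + n)) :=
  frame_class @` [set X : 'M[R]_(n + n, n) | forall i j, is_sign (X i j)].

Lemma reduce_Siegel_coset g : Sp R n g ->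
  exists2 b, upper_triangular R n b &
    sign_cosets (lmul (levi b) (lmul g (Siegel R n))).
Proof.
move=> Sg; have [CD [X [Y XY]]] := Sp_lagrangian Sg.
have [c [h [tc uc uh] hs]] := lagrangian_normal_form CD XY.
have uct : c^T \in unitmx by rewrite unitmx_tr.
have ub : invmx c^T \in unitmx by rewrite unitmx_inv.
exists (invmx c^T).
  by split=> //; rewrite trmx_inv trmxK trig_mxV.
rewrite lmul_Siegel // lmul_frame_class; last exact: Sp_levi.
rewrite -(frame_classM _ uh); eexists; last by [].
have -> : lsubmx g = col_mx (ulsubmx g) (dlsubmx g).
  by rewrite -{1}[g]submxK block_mxEh row_mxKl.
rewrite /levi trmx_inv trmxK invmxK mul_block_col !mul0mx addr0 add0r.
rewrite mul_col_mx => i j; rewrite -(splitK i).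
case: (fintype.split i) => k /=; rewrite ?col_mxEu ?col_mxEd.
  by case: (hs k j).
by case: (hs k j).
Qed.

End SymplecticGroup.

Lemma finite_sign_mx (F : rcfType) m n :
  finite_set [set X : 'M[F]_(m, n) | forall i j, is_sign (X i j)].
Proof.
pose s : seq F := [:: 0; 1; -1]; pose S : set 'M['I_3]_(m, n) := setT.
apply: (@sub_finite_set _ _ (map_mx (fun k : 'I_3 => s`_k) @` S)); last first.
  exact/finite_image/finite_finset.
move=> X hX; exists (map_mx (fun x => inord (index x s)) X) => //.
apply/matrixP => i j; rewrite !mxE inordK ?nth_index //; first exact: hX.
by rewrite index_mem; exact: hX.
Qed.

(** * Finiteness of orbits *)

Section MatrixGroups.
Variable R : realType.

Definition matrix_group N (H : set 'M[R]_N) :=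
  [/\ H `<=` GL R N, forall g h, H g -> H h -> H (g *m h)
    & forall g, H g -> H (invmx g)].

(** An orbit is determined by any of its points because [H] is a group. *)
Lemma finite_orbits N (T : Type) (act : 'M[R]_N -> T -> T) H (X Y : set T) :
    (forall x, act 1%:M x = x) ->
    (forall g h x, act g (act h x) = act (g *m h) x) ->
    matrix_group H -> finite_set Y ->
    (forall x, X x -> exists2 h, H h & Y (act h x)) ->
  finite_set (orbits act H X).
Proof.
move=> act1 actM [HGL HM HV] finY redX.
apply: (@sub_finite_set _ _ (orbit_of act H @` Y)); last exact: finite_image.
move=> _ [x Xx <-]; have [h Hh Yhx] := redX x Xx; exists (act h x) => //.
apply/seteqP; split=> _ [k Hk <-].
  by exists (k *m h); [exact: HM|rewrite actM].
exists (k *m invmx h); first by apply: HM => //; exact: HV.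
by rewrite actM mulmxKV //; exact: HGL.
Qed.

Lemma lmul1 N (A : set 'M[R]_N) : lmul 1%:M A = A.
Proof.
apply/seteqP; split=> [_ [x Ax <-]|x Ax]; first by rewrite mul1mx.
by exists x; rewrite ?mul1mx.
Qed.

Lemma lmulM N g h (A : set 'M[R]_N) : lmul g (lmul h A) = lmul (g *m h) A.
Proof.
apply/seteqP; split=> [_ [_ [x Ax <-] <-]|_ [x Ax <-]].
  by exists x; rewrite ?mulmxA.
by exists (h *m x); [exists x|rewrite mulmxA].
Qed.

Lemma lmul_group N (H : set 'M[R]_N) h : matrix_group H -> H h -> lmul h H = H.
Proof.
move=> [HGL HM HV] Hh; apply/seteqP; split=> [_ [k Hk <-]|k Hk]; first exact: HM.
exists (invmx h *m k); first by apply: HM => //; exact: HV.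
by rewrite mulKVmx //; exact: HGL.
Qed.

Lemma GL_group N : matrix_group (GL R N).
Proof.
split=> // [g h ug uh|g ug]; rewrite /GL /= ?unitmx_inv //.
by rewrite unitmx_mul ug.
Qed.

Lemma upper_triangular_group n : matrix_group (upper_triangular R n).
Proof.
split=> [g []//|g h [ug tg] [uh th]|g [ug tg]]; split.
- by rewrite /GL /= unitmx_mul ug.
- by rewrite trmx_mul trig_mxM.
- by rewrite /GL /= unitmx_inv.
- by rewrite trmx_inv trig_mxV // unitmx_tr.
Qed.

Lemma conj_group N (H : set 'M[R]_N) a : a \in unitmx -> matrix_group H ->
  matrix_group [set a *m b *m invmx a | b in H].
Proof.
move=> ua [HGL HM HV]; split=> [_ [b /HGL ub <-]|_ _ [b Hb <-] [c Hc <-]|_ [b Hb <-]].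
- by rewrite /GL /= !unitmx_mul ua ub unitmx_inv.
- by exists (b *m c); [exact: HM|rewrite !mulmxA mulmxKV].
exists (invmx b); first exact: HV.
have ub := HGL _ Hb; rewrite /GL /= in ub.
have uab : a *m b *m invmx a \in unitmx by rewrite !unitmx_mul ua ub unitmx_inv.
apply: (can_inj (mulKmx uab)).
by rewrite mulmxV // !mulmxA mulmxKV // mulmxK // mulmxV.
Qed.

Lemma levi_group n (H : set 'M[R]_n) :
  matrix_group H -> matrix_group (@levi R n @` H).
Proof.
move=> [HGL HM HV]; split=> [_ [b /HGL ub <-]|_ _ [b Hb <-] [c Hc <-]|_ [b Hb <-]].
- exact: levi_unit.
- by exists (b *m c); [exact: HM|apply: leviM; exact: HGL].
- by exists (invmx b); [exact: HV|apply: leviV; exact: HGL].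
Qed.

End MatrixGroups.

Theorem theorem2p7 (R : realType) (n : nat) (hn : (0 < n)%N)
    (B : set 'M[R]_(n + n)) (hB : Borel B) :
  finite_set (orbits (@diag_lmul R (n + n)) (Levi R n)
    (left_cosets (Sp R n) (Siegel R n) `*` left_cosets (Levi R n) B))
  /\ finite_set (orbits (@lmul R (n + n)) B
       (left_cosets (Sp R n) (Siegel R n))).
Proof.
case: hB => a ua eB; rewrite /GL /= in ua.
have grpB : matrix_group B.
  by rewrite eB; apply/levi_group/conj_group/upper_triangular_group.
have grpL : matrix_group (Levi R n) by exact/levi_group/GL_group.
have BL : B `<=` Levi R n.
  rewrite eB => _ [_ [b [ub _] <-] <-].
  by eexists; last by []; rewrite /GL /= !unitmx_mul ua ub unitmx_inv.
pose Y := lmul (levi a) @` @sign_cosets R n.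
have finY : finite_set Y.
  by apply: finite_image; apply: finite_image; exact: finite_sign_mx.
have redB g : Sp R n g -> exists2 b, B b & Y (lmul b (lmul g (Siegel R n))).
  move=> Sg; have [|b [ub tb] sb] := @reduce_Siegel_coset R n (levi (invmx a) *m g).
    by apply: SpM => //; apply: Sp_levi; rewrite unitmx_inv.
  exists (levi (a *m b *m invmx a)).
    by rewrite eB; eexists; last by []; exists b.
  eexists; first exact: sb.
  by rewrite !lmulM !leviM ?unitmx_mul ?unitmx_inv ?ua ?ub // !mulmxA.
have [LGL LM LV] := grpL.
split.
  apply: (@finite_orbits _ _ _ _ _ _ (Y `*` [set B])) => //.
  - by case=> A C; rewrite /diag_lmul !lmul1.
  - by move=> g h [A C]; rewrite /diag_lmul !lmulM.
  - by apply: finite_setX => //; exact: finite_set1.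
  move=> [x y] /= [[g Sg <-] [l Ll <-]].
  have Sl : Sp R n (invmx l).
    by case: (LV _ Ll) => k uk <-; exact: Sp_levi.
  have [b Bb Yb] := redB _ (SpM Sl Sg).
  (* [l^-1] moves the second coset to [B], which is then fixed by [b]. *)
  exists (b *m invmx l); first by apply: LM; [exact: BL|exact: LV].
  split; rewrite /= lmulM -mulmxA; first by rewrite -lmulM.
  by rewrite mulVmx ?mulmx1 ?lmul_group //; exact: LGL.
apply: (@finite_orbits _ _ _ _ _ _ Y) => //.
- exact: lmul1.
- exact: lmulM.
by move=> _ [g Sg <-]; exact: redB.
Qed.
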